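(* Let $X$ be a Banach space. For every $X$-valued cylindrical function $F\in\mathscr{C}(\Omega;X)$ and every $B\in\mathcal{E}_\mu$, $$\mathbb{E}\int_B DF\,\mathrm{d}\mu=\mathbb{E}\big(\tilde N(B)F\big).$$
   Context: Poisson random measure: $(\Omega,\mathcal{F},\mathbb{P})$ is a probability space, $(E,\mathcal{E})$ a measurable space, and $N$ is a Poisson random measure on $(E,\mathcal{E})$ with $\sigma$-finite intensity measure $\mu$, i.e. a map $N:\Omega\times\mathcal{E}\to\mathbb{N}\cup\{\infty\}$ such that $N(B)$ is a random variable for each $B\in\mathcal{E}$, $N(\omega,\cdot)$ is a measure for each $\omega$, $N(B)$ is Poisson distributed with parameter $\mu(B)$ ($N(B)=\infty$ a.s. if $\mu(B)=\infty$), and $N(B_1),\dots,N(B_n)$ are independent for pairwise disjoint $B_1,\dots,B_n$. Put $\mathcal{E}_\mu=\{B\in\mathcal{E}:\mu(B)<\infty\}$ and $\tilde N(B)=N(B)-\mu(B)$ for $B\in\mathcal{E}_\mu$. Cylindrical functions: a (real) cylindrical function is a random variable $F=f(N(B_1),\dots,N(B_M))$ with $M\ge 1$, $f:\mathbb{N}^M\to\mathbb{R}$ ($0\in\mathbb{N}$) and $B_1,\dots,B_M\in\mathcal{E}_\mu$, which may always be taken pairwise disjoint. $\mathscr{C}(\Omega)$ is the real vector space of these, and $\mathscr{C}(\Omega;X)=\mathscr{C}(\Omega)\otimes X$ consists of all $F=\sum_{i=1}^n F_i\otimes x_i$ with $n\ge1$, $F_i\in\mathscr{C}(\Omega)$,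 $x_i\in X$. Malliavin derivative: writing $F=\sum_{i=1}^n f_i(N(\mathbf{B}))\otimes x_i\in\mathscr{C}(\Omega;X)$ with $N(\mathbf{B})=(N(B_1),\dots,N(B_M))$, $B_1,\dots,B_M\in\mathcal{E}_\mu$ pairwise disjoint, and $\mathbf{e}_m$ the $m$-th unit vector of $\mathbb{R}^M$, $$DF=\sum_{i=1}^n\sum_{m=1}^M\big(f_i(N(\mathbf{B})+\mathbf{e}_m)-f_i(N(\mathbf{B}))\big)\otimes(\mathbf 1_{B_m}\otimes x_i),$$ a random variable with values in $L^2(E,\mu)\otimes X$; it does not depend on the representation of $F$.
   Formalization: Since f is arbitrary, the expectations may fail to exist (e.g. F = N(B_1)+g(N(B_2)) with g(N(B_2)) not integrable); the identity is asserted whenever both ∫_B DF dμ and Ñ(B)F are Bochner integrable over Ω. *)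

(* Defs.v *)
From HB Require Import structures.
From mathcomp Require Import all_boot all_order all_algebra.
From mathcomp Require Import all_classical all_reals all_analysis.
From mathcomp Require Import measurable_realfun.

Set Implicit Arguments.
Unset Strict Implicit.
Unset Printing Implicit Defensive.

Import Order.TTheory GRing.Theory Num.Theory.
Import numFieldNormedType.Exports.

Local Open Scope classical_set_scope.
Local Open Scope ring_scope.

Section bochner.
Context {d : measure_display} {T : measurableType d} {R : realType}
  {X : completeNormedModType R}.
Variable mu : {measure set T -> \bar R}.

Definition integrable_simple (s : {fimfun T >-> X}) : Prop :=
  (forall x, measurable (s @^-1` [set x])) /\
  (forall x, x != 0 -> (mu (s @^-1` [set x]) < +oo)%E).

(* The set [s = 0] may have infinite measure; its term is harmless since
   [fine +oo = 0] and it multiplies the zero vector anyway. *)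
Definition simple_bochner (s : {fimfun T >-> X}) : X :=
  \sum_(x \in [set: X]) fine (mu (s @^-1` [set x])) *: x.

Definition bochner_approx (f : T -> X) (s : nat -> {fimfun T >-> X}) : Prop :=
  [/\ forall n, integrable_simple (s n),
      {ae mu, forall t, s n t @[n --> \oo] --> f t} &
      (\int[mu]_t (`|f t - s n t|)%:E)%E @[n --> \oo] --> 0%E].

Definition bochner_integrable (f : T -> X) : Prop :=
  exists s, bochner_approx f s.

(* The limit is the same for all approximating sequences; the value is the
   junk value 0 if [f] is not Bochner integrable. *)
Definition bochner (f : T -> X) : X :=
  xget 0 [set v | exists2 s, bochner_approx f s &
                    simple_bochner (s n) @[n --> \oo] --> v].

Definition bochner_on (D : set T) (f : T -> X) : X :=
  bochner (fun t => (\1_D t : R) *: f t).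

End bochner.

Section poisson_random_measure.
Context {dO dE : measure_display} {Omega : measurableType dO}
  {E : measurableType dE} {R : realType}.
Variables (P : probability Omega R) (mu : {measure set E -> \bar R}).

(* Taking all the [A i] in the product rule yields the rule for every
   subfamily, by choosing [A i = setT] for the other indices. *)
Definition independent_RVs n (Y : 'I_n -> Omega -> \bar R) : Prop :=
  forall A : 'I_n -> set (\bar R), (forall i, measurable (A i)) ->
    P (\bigcap_(i in [set: 'I_n]) (Y i @^-1` A i)) =
    (\prod_(i < n) P (Y i @^-1` A i))%E.

(* A kernel [N] is a family of measures [N w] such that [w |-> N w B] is
   measurable for every measurable [B].  The second argument of
   [poisson_prob] is a dummy, and [poisson_prob 0] is the Dirac mass at 0. *)
Definition poisson_random_measure (N : R.-ker Omega ~> E) : Prop :=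
  [/\ forall w B, measurable B ->
        N w B = +oo%E \/ exists k : nat, N w B = k%:R%:E,
      forall B, measurable B -> (mu B < +oo)%E -> forall k : nat,
        P [set w | N w B = k%:R%:E] = poisson_prob (fine (mu B)) 0%N [set k],
      forall B, measurable B -> mu B = +oo%E ->
        {ae P, forall w, N w B = +oo%E} &
      forall n (B : 'I_n -> set E), (forall i, measurable (B i)) ->
        trivIset setT B -> independent_RVs (fun i w => N w (B i))].

Definition finite_measure_set (B : set E) : Prop :=
  measurable B /\ (mu B < +oo)%E.

Variable N : R.-ker Omega ~> E.

Definition compensated (B : set E) (w : Omega) : R :=
  fine (N w B) - fine (mu B).

(* The natural-number vector (N(B_1), ..., N(B_M)).  If mu (B m) < +oo then
   N(B_m) is finite almost surely; an infinite value is replaced by 0. *)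
Definition counts M (B : 'I_M -> set E) (w : Omega) : 'rV[nat]_M :=
  \row_m Num.truncn (fine (N w (B m))).

(* Random variables are identified when they are almost surely equal. *)
Definition cylindrical (F : {RV P >-> R}) : Prop :=
  exists M (f : 'rV[nat]_M.+1 -> R) (B : 'I_M.+1 -> set E),
    (forall m, finite_measure_set (B m)) /\
    {ae P, forall w, F w = f (counts B w)}.

Context {X : completeNormedModType R}.

Definition vcylindrical (F : Omega -> X) : Prop :=
  exists n (G : 'I_n.+1 -> {RV P >-> R}) (x : 'I_n.+1 -> X),
    (forall i, cylindrical (G i)) /\
    (forall w, F w = \sum_i G i w *: x i).

(* An element of L^2(E, mu) (x) X is represented by a function E -> X, the
   tensor g (x) x being [fun e => g e *: x]. *)
Definition is_malliavin (F : Omega -> X) (DF : Omega -> E -> X) : Prop :=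
  exists n M (f : 'I_n.+1 -> 'rV[nat]_M.+1 -> R)
      (B : 'I_M.+1 -> set E) (x : 'I_n.+1 -> X),
    [/\ forall m, finite_measure_set (B m),
        trivIset setT B,
        {ae P, forall w, F w = \sum_i f i (counts B w) *: x i} &
        DF = fun w e => \sum_i \sum_m
          (f i (counts B w + delta_mx 0 m) - f i (counts B w)) *:
            ((\1_(B m) e : R) *: x i)].

(* Every vector-valued cylindrical function has a representation over pairwise
   disjoint sets, and different ones give the same derivative up to null
   sets; the derivative is read off from a chosen one. *)
Definition malliavin (F : Omega -> X) : Omega -> E -> X :=
  xget (fun _ _ => 0) [set DF | is_malliavin F DF].

End poisson_random_measure.

(* Main.v *)
Require Import Defs.
From HB Require Import structures.
From mathcomp Require Import all_boot all_order all_algebra.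
From mathcomp Require Import all_classical all_reals all_analysis.
From mathcomp Require Import measurable_realfun.
From mathcomp Require Import ring zify.

(** Refine the sets on which F depends, together with B, into the disjoint cells
that they cut out.  Almost surely F is then a function g of the vector of
counts of the cells, whose entries are independent Poisson variables with
parameters lam S, and both sides are expectations of functions of this vector
alone:

- an extra point in the cell S shifts the count of S by one, so integrating
  the derivative over B gives the sum over the cells S inside B of
  lam S (g (v + 1_S) - g v) ([bochner_on_derivative]);
- the compensated count of B times F is (a v - L) g v, where a v is the total
  count of the cells inside B and L = mu B.

With p v the product of Poisson weights, lam S * p v =
(v S + 1) * p (v + 1_S) ([weight_bump]).  Summation by parts over the box of
vectors with entries at most n therefore turns one expectation into the other
up to the faces v S = n of the box ([sum_by_parts]), and these vanish in the
limit as soon as lam S |g (v + 1_S)| is summable for the weights p.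

This summability is not immediate, since only the two integrands are
integrable, and F itself need not a priori be: the factor a v - L kills F
where a v = L.  Away from the level a v = L the factor is bounded below, so g
and, after shifting by the weight identity, the shifted terms
lam S g (v + 1_S) on the level a v = L are summable; on that level the first
integrand is the sum of these shifted terms minus L g v, whence g is summable
there too when L > 0 ([summable_bump]).  When L = 0 all lam S inside B vanish
and so do the contributions of the faces.

Bochner integrals enter only through approximating sequences.  Two such
sequences for the same function have asymptotic integrals, so it suffices to
compare the truncations of the two integrands to the boxes
([bochner_eq_of_approx], [bochner_approx_truncation]); the existence of the
limits never has to be addressed.

The derivative is defined from some representation over disjoint sets, so
one must also know that there is one ([vcylindrical_disjoint]); this again
comes from the cells of all the sets involved. *)

Set Implicit Arguments.
Unset Strict Implicit.
Unset Printing Implicit Defensive.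

Import Order.TTheory GRing.Theory Num.Theory.
Import numFieldNormedType.Exports.

Local Open Scope classical_set_scope.
Local Open Scope ring_scope.

(** * Functions with countably many values *)

Section discrete_functions.
Context {d : measure_display} {T : measurableType d}.

(** A Banach space carries no sigma-algebra here.  Functions with countably many
values and measurable fibres serve as measurable functions instead: they are
stable under pairing and under composition with arbitrary maps, and all the
integrands below are of this kind up to null sets. *)
Definition discrete {Y : Type} (u : T -> Y) : Prop :=
  countable (range u) /\ forall y, measurable (u @^-1` [set y]).

Lemma discrete_preimage (Y : Type) (u : T -> Y) (A : set Y) :
  discrete u -> measurable (u @^-1` A).
Proof.
move=> [cu mu].
have : countable (range u `&` A).
  by apply: sub_countable cu; apply: subset_card_le => y [].
have -> : u @^-1` A = u @^-1` (range u `&` A).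
  by apply/seteqP; split => [t At|t [_ At]//]; split => //; exists t.
case/pfcard_geP => [->|[g]]; first by rewrite preimage_set0.
have -> : range u `&` A = range g.
  apply/seteqP; split => [y Ay|_ [n _ <-]]; last exact: (@funS _ _ setT _ g).
  by have [n _ <-] := @surj _ _ setT _ g y Ay; exists n.
have -> : u @^-1` range g = \bigcup_n u @^-1` [set g n].
  apply/seteqP; split => [t [n _ gn]|t [n _ /= gn]]; first by exists n.
  by exists n.
exact: bigcupT_measurable.
Qed.

Lemma discrete_comp (Y Z : Type) (h : Y -> Z) (u : T -> Y) :
  discrete u -> discrete (h \o u).
Proof.
move=> du; split=> [|z]; last by rewrite comp_preimage; exact: discrete_preimage.
have -> : range (h \o u) = h @` range u by rewrite image_comp.
exact: (sub_countable (card_image_le _ _) du.1).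
Qed.

Lemma discrete_pair (Y Z : Type) (u : T -> Y) (v : T -> Z) :
  discrete u -> discrete v -> discrete (fun t => (u t, v t)).
Proof.
move=> du dv; split=> [|[y z]].
  apply: (sub_countable _ (countableX du.1 dv.1)); apply: subset_card_le.
  by move=> _ [t _ <-]; split; exists t.
have -> : (fun t => (u t, v t)) @^-1` [set (y, z)] =
    u @^-1` [set y] `&` v @^-1` [set z].
  by apply/seteqP; split => t /= [-> ->].
by apply: measurableI; [apply: du.2|apply: dv.2].
Qed.

Lemma discrete_measurable (d' : measure_display) (Z : measurableType d')
  (Y : Type) (h : Y -> Z) (u : T -> Y) :
  discrete u -> measurable_fun setT (h \o u).
Proof.
move=> du _ A _; rewrite setTI comp_preimage; exact: discrete_preimage.
Qed.

Lemma discrete_finite (Y : Type) (u : T -> Y) :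
  finite_set (range u) -> (forall y, measurable (u @^-1` [set y])) ->
  discrete u.
Proof. by move=> fu mu; split=> //; exact: finite_set_countable. Qed.

End discrete_functions.

Section fiberwise.
Context {d : measure_display} {T : measurableType d} {R : realType}.
Variable mu : {measure set T -> \bar R}.

Lemma integral_fiberwise (Y : choiceType) (u : T -> Y) (r : Y -> R)
    (D : set Y) :
  finite_set D -> (forall y, measurable (u @^-1` [set y])) ->
  (forall y, 0 <= r y) -> (forall t, ~ D (u t) -> r (u t) = 0) ->
  (\int[mu]_t (r (u t))%:E =
   \sum_(y \in D) (r y)%:E * mu (u @^-1` [set y]))%E.
Proof.
move=> fD mu_ r0 rD.
transitivity (\int[mu]_t (\sum_(y \in D)
    (r y * \1_(u @^-1` [set y]) t)%:E))%E.
  apply: eq_integral => t _; rewrite fsumEFin//; congr EFin.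
  have [Dt|nDt] := pselect (D (u t)).
    rewrite (fsbigD1 (u t))//= ?indicE ?mem_set//= mulr1 fsbig1 ?addr0// => y.
    move=> [_ yt]; rewrite indicE memNset ?mulr0//= => ty; exact: yt.
  rewrite rD// fsbig1// => y Dy; rewrite indicE memNset ?mulr0//= => ty.
  by rewrite ty in nDt.
rewrite ge0_integral_fsum//.
- apply: eq_fsbigr => y _; under eq_integral do rewrite EFinM.
  rewrite ge0_integralZl//; last by rewrite lee_fin.
    by rewrite integral_indic// setIT.
  by apply/measurable_EFinP; exact: measurable_indic.
- move=> y; apply/measurable_EFinP; apply: measurable_funM => //.
- by move=> y t _; rewrite lee_fin mulr_ge0.
Qed.

(** Each finite partial sum is the integral of the function truncated to finitely
many fibres. *)
Lemma esum_fiberwise_le (Y : choiceType) (u : T -> Y) (r : Y -> R) :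
  discrete u -> (forall y, 0 <= r y) ->
  (\esum_(y in setT) (fine (mu (u @^-1` [set y])) * r y)%:E <=
   \int[mu]_t (r (u t))%:E)%E.
Proof.
move=> du r0; apply: ge_ereal_sup => _ [A [fA _] <-].
pose rA y := if y \in A then r y else 0.
apply: (@le_trans _ _ (\int[mu]_t (rA (u t))%:E)%E); last first.
  apply: ge0_le_integral => //.
  - by move=> t _; rewrite lee_fin /rA; case: ifP.
  - exact: (discrete_measurable (EFin \o rA) du).
  - exact: (discrete_measurable (EFin \o r) du).
  - by move=> t _; rewrite lee_fin /rA; case: ifP.
rewrite (@integral_fiberwise _ u rA A)//; last 3 first.
- exact: du.2.
- by move=> y; rewrite /rA; case: ifP.
- by move=> t At; rewrite /rA memNset.
apply: lee_fsum => // y Ay; rewrite /rA mem_set// mulrC EFinM.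
apply: lee_wpmul2l; first by rewrite lee_fin.
have : (0 <= mu (u @^-1` [set y]))%E by [].
by case: (mu _) => [r'| |] //= _; rewrite leey.
Qed.

End fiberwise.

(** * The Bochner integral *)

Section bochner_theory.
Context {d : measure_display} {T : measurableType d} {R : realType}
  {X : completeNormedModType R}.
Variable mu : {measure set T -> \bar R}.
Implicit Types (f g : T -> X) (s : {fimfun T >-> X}).

(** The integral of a simple function may be computed on any finer measurable
partition.  Using the joint fibres of two simple functions, this replaces the
additivity of the integral. *)
Lemma simple_bochner_fiberwise (Y : choiceType) (u : T -> Y) (phi : Y -> X)
    (D : set Y) s :
  finite_set D -> (forall y, measurable (u @^-1` [set y])) ->
  (forall t, ~ D (u t) -> phi (u t) = 0) ->
  (forall y, phi y != 0 -> (mu (u @^-1` [set y]) < +oo)%E) ->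
  (forall t, s t = phi (u t)) ->
  simple_bochner mu s = \sum_(y \in D) fine (mu (u @^-1` [set y])) *: phi y.
Proof.
move=> fD mu_ phiD phifin su.
pose F (y : Y) (x : X) := if phi y == x then fine (mu (u @^-1` [set y])) *: x else 0.
have fI : finite_set (phi @` D) by exact: finite_image.
transitivity (\sum_(x \in phi @` D) \sum_(y \in D) F y x); last first.
  rewrite exchange_fsbig//; apply: eq_fsbigr => y /set_mem Dy.
  rewrite (fsbigD1 (phi y))//=; last by exists y.
  rewrite /F eqxx fsbig1 ?addr0// => x [_ xy]; rewrite ifN//.
  by apply/eqP => yx; exact: xy.
rewrite /simple_bochner; rewrite -(@fsbig_widen _ _ _ _ (phi @` D))//.
  apply: eq_fsbigr => x /set_mem _.
  have [->|x0] := eqVneq x 0.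
    by rewrite scaler0 fsbig1// => y _; rewrite /F scaler0 if_same.
  have -> : s @^-1` [set x] = \bigcup_(y in D `&` phi @^-1` [set x]) u @^-1` [set y].
    apply/seteqP; split => [t /= sx|t [y [_ /= px] /= uy]]; last by rewrite su uy.
    exists (u t) => //; split; last by rewrite /= -su.
    by apply: contrapT => /phiD; rewrite -su sx; exact/eqP.
  rewrite measure_fin_bigcup//; last 2 first.
  - exact: finite_setIl.
  - by move=> y z _ _ [t [/= <- <-]].
  rewrite (_ : (\sum_(y \in _) _)%E = (\sum_(y \in D `&` phi @^-1` [set x])
     fine (mu (u @^-1` [set y])))%:E); last first.
    rewrite -fsumEFin; last exact: finite_setIl.
    apply: eq_fsbigr => y /set_mem [_ /= px]; rewrite fineK// ge0_fin_numE//.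
    by apply: phifin; rewrite px.
  rewrite /= fsbig_mkcondr fsbig_finite// fsbig_finite//= scaler_suml.
  apply: eq_bigr => y _; rewrite /patch /F; have [py|/eqP py] := eqVneq (phi y) x.
    by rewrite mem_set//= py.
  by rewrite memNset// scale0r.
move=> x [_ /= Dx]; have [->|x0] := eqVneq x 0; first by rewrite scaler0.
rewrite (_ : _ @^-1` _ = set0) ?measure0 ?scale0r//.
rewrite -subset0 => t /= sx; apply: Dx; exists (u t); last by rewrite -su.
by apply: contrapT => /phiD; rewrite -su sx; exact/eqP.
Qed.

Lemma simple_bochner_dist s s' :
  integrable_simple mu s -> integrable_simple mu s' ->
  (`|simple_bochner mu s - simple_bochner mu s'|%:E <=
   \int[mu]_t `|s t - s' t|%:E)%E.
Proof.
move=> [ms fs] [ms' fs'].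
pose u t := (s t, s' t).
have ds := discrete_finite (fimfunP s) ms.
have ds' := discrete_finite (fimfunP s') ms'.
have mu_ : forall y, measurable (u @^-1` [set y]) by have [] := discrete_pair ds ds'.
pose D := range s `*` range s'.
have fD : finite_set D by exact: finite_setX.
have fin1 (y : X * X) : y.1 != 0 -> (mu (u @^-1` [set y]) < +oo)%E.
  move=> /fs; apply: le_lt_trans; apply: le_measure; rewrite ?inE//.
  by move=> t /= <-.
have fin2 (y : X * X) : y.2 != 0 -> (mu (u @^-1` [set y]) < +oo)%E.
  move=> /fs'; apply: le_lt_trans; apply: le_measure; rewrite ?inE//.
  by move=> t /= <-.
have uD t : D (u t) by split; exists t.
rewrite (@simple_bochner_fiberwise _ u fst D s)//.
rewrite (@simple_bochner_fiberwise _ u snd D s')//.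
rewrite (@integral_fiberwise _ _ _ mu _ u (fun y => `|y.1 - y.2|) D)//.
rewrite !fsbig_finite//= -sumrB.
rewrite (eq_bigr (fun y => (`|y.1 - y.2| *
    fine (mu (u @^-1` [set y])))%:E)) => [|y _]; last first.
  have [->|cy] := eqVneq y.1 y.2; first by rewrite subrr normr0 mul0r mul0e.
  rewrite EFinM fineK// ge0_fin_numE//.
  have [y1|] := eqVneq y.1 0; last exact: fin1.
  apply: fin2; apply: contra cy => /eqP y2.
  by rewrite y1 y2.
rewrite sumEFin lee_fin; apply: le_trans (ler_norm_sum _ _ _) _.
apply: ler_sum => y _; rewrite -scalerBr normrZ mulrC ger0_norm//.
Qed.

Lemma integrable_simple_discrete s : integrable_simple mu s -> discrete s.
Proof. by move=> [ms _]; exact: discrete_finite (fimfunP s) ms. Qed.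

Lemma discrete_normB f g : discrete f -> discrete g ->
  measurable_fun setT (fun t => `|f t - g t|%:E).
Proof.
move=> df dg.
exact: (discrete_measurable (fun p : X * X => `|p.1 - p.2|%:E)
  (discrete_pair df dg)).
Qed.

(** The distance of the integrals is at most the integral of |s n - s' n|, hence
of |f - s n| + |f - s' n|. *)
Lemma bochner_approx_dist f (s s' : nat -> {fimfun T >-> X}) :
  discrete f -> bochner_approx mu f s -> bochner_approx mu f s' ->
  simple_bochner mu (s n) - simple_bochner mu (s' n) @[n --> \oo] --> 0.
Proof.
move=> df [is_ _ sf] [is' _ sf'].
have H : (`|simple_bochner mu (s n) - simple_bochner mu (s' n)|%:E
    @[n --> \oo] --> 0)%E.
  apply: (@squeeze_cvge _ _ _ _ (cst 0%E) _ (fun n =>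
    \int[mu]_t `|f t - s n t|%:E + \int[mu]_t `|f t - s' n t|%:E)%E).
  - apply: nearW => n; rewrite lee_fin normr_ge0/=.
    apply: le_trans (simple_bochner_dist (is_ n) (is' n)) _.
    have dn := integrable_simple_discrete (is_ n).
    have dn' := integrable_simple_discrete (is' n).
    rewrite -ge0_integralD//; last 2 first.
    + exact: discrete_normB.
    + exact: discrete_normB.
    apply: ge0_le_integral => //.
    + exact: discrete_normB.
    + by apply: emeasurable_funD; exact: discrete_normB.
    + move=> t _; rewrite -EFinD lee_fin.
      by rewrite (distrC (f t)); exact: ler_distD.
  - exact: cvg_cst.
  - by rewrite -[X in _ --> X]adde0; apply: cvgeD.
apply/norm_cvg0P; move/fine_cvgP : H => [_]; exact.
Qed.

(** The two sets of limits among which [bochner] chooses coincide, because any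
approximation of f is asymptotic to s, hence to s'.  In particular both are
empty at once. *)
Lemma bochner_eq_of_approx f g (s s' : nat -> {fimfun T >-> X}) :
  discrete f -> discrete g ->
  bochner_approx mu f s -> bochner_approx mu g s' ->
  simple_bochner mu (s n) - simple_bochner mu (s' n) @[n --> \oo] --> 0 ->
  bochner mu f = bochner mu g.
Proof.
have sub f' g' (t t' : nat -> {fimfun T >-> X}) : discrete f' ->
    bochner_approx mu f' t -> bochner_approx mu g' t' ->
    simple_bochner mu (t n) - simple_bochner mu (t' n) @[n --> \oo] --> 0 ->
    [set v : X | exists2 s, bochner_approx mu f' s &
      simple_bochner mu (s n) @[n --> \oo] --> v] `<=`
    [set v : X | exists2 s, bochner_approx mu g' s &
      simple_bochner mu (s n) @[n --> \oo] --> v].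
  move=> df ft gt tt' v [r fr rv]; exists t' => //.
  have -> : v = v - 0 - 0 by rewrite !subr0.
  rewrite (_ : (fun n => _) = fun n => simple_bochner mu (r n)
    - (simple_bochner mu (r n) - simple_bochner mu (t n))
    - (simple_bochner mu (t n) - simple_bochner mu (t' n))); last first.
    by apply/funext => n; rewrite subKr subKr.
  by apply: cvgB => //; apply: cvgB => //; exact: bochner_approx_dist fr ft.
move=> df dg fs gs' ss'; rewrite /bochner; congr (xget 0 _).
apply/seteqP; split; first exact: sub ss'.
apply: sub gs' fs _ => //.
rewrite -oppr0 (_ : (fun n => _) = fun n =>
  - (simple_bochner mu (s n) - simple_bochner mu (s' n))).
  exact: cvgN.
by apply/funext => n; rewrite opprB.
Qed.

Lemma bochner_simple s : integrable_simple mu s ->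
  bochner mu s = simple_bochner mu s.
Proof.
move=> is_.
have ss : bochner_approx mu s (fun=> s).
  split=> //; first by apply: aeW => t; exact: cvg_cst.
  under eq_fun do under eq_integral do rewrite subrr normr0.
  by rewrite integral0; exact: cvg_cst.
apply: xget_unique; first by exists (fun=> s) => //; exact: cvg_cst.
move=> v [r sr rv].
have := bochner_approx_dist (integrable_simple_discrete is_) sr ss.
have : simple_bochner mu (r n) - simple_bochner mu s @[n --> \oo] --> v - simple_bochner mu s.
  by apply: cvgB => //; exact: cvg_cst.
move=> /cvg_unique H /H; move/(_ (@norm_hausdorff _ _)) => /eqP.
by rewrite subr_eq0 => /eqP.
Qed.

Import HBNNSimple.

(** For functions that need not be measurable the integral is a supremum over
simple minorants.  Setting a minorant to 0 on the exceptional null set keeps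
its integral. *)
Lemma le_lower_integral_ae (h k : T -> \bar R) :
  (forall t, 0 <= h t)%E -> (forall t, 0 <= k t)%E ->
  {ae mu, forall t, h t = k t} ->
  (\int[mu]_t h t <= \int[mu]_t k t)%E.
Proof.
move=> h0 k0 [Z [mZ Z0 hk]].
rewrite !ge0_integralTE//; apply: ge_ereal_sup => _ [q /= qh <-].
pose q' := proj_nnsfun q (measurableC mZ).
apply: ereal_sup_ubound; exists q'.
  move=> t /=; rewrite mindicE; have [Zt|Zt] := pselect (Z t).
    by rewrite memNset ?mulr0//=; exact.
  rewrite mem_set// mulr1.
  rewrite (_ : k t = h t)//; apply: contrapT => /nesym kh; exact/Zt/hk.
rewrite -(@integralT_nnsfun _ _ _ mu q) -(@integralT_nnsfun _ _ _ mu q').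
apply: ge0_ae_eq_integral => //.
- by apply/measurable_EFinP; exact: measurable_funPT.
- by apply/measurable_EFinP; exact: measurable_funPT.
- by move=> t _; rewrite lee_fin; exact: fun_ge0.
- by move=> t _; rewrite lee_fin; exact: fun_ge0.
exists Z; split => // t /= /not_implyP[_ qt]; apply: contrapT => Zt.
by apply: qt; rewrite /q' /= mindicE mem_set// mulr1.
Qed.

Lemma lower_integral_ae (h k : T -> \bar R) :
  (forall t, 0 <= h t)%E -> (forall t, 0 <= k t)%E ->
  {ae mu, forall t, h t = k t} ->
  (\int[mu]_t h t = \int[mu]_t k t)%E.
Proof.
move=> h0 k0 hk; apply/eqP; rewrite eq_le !le_lower_integral_ae//.
by apply: filterS hk => t ->.
Qed.

Lemma bochner_approx_ae f g (s_ : nat -> {fimfun T >-> X}) : {ae mu, forall t, f t = g t} ->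
  bochner_approx mu f s_ -> bochner_approx mu g s_.
Proof.
move=> fg [is_ sf If]; split=> //.
  by apply: filterS2 fg sf => t <-.
apply: cvg_trans If; apply: near_eq_cvg; apply: nearW => n.
apply: lower_integral_ae => [t|t|]; rewrite ?lee_fin//.
by apply: filterS fg => t ->.
Qed.

Lemma bochner_integrable_ae f g : {ae mu, forall t, f t = g t} ->
  bochner_integrable mu f -> bochner_integrable mu g.
Proof. by move=> fg [s fs]; exists s; exact: bochner_approx_ae fs. Qed.

Lemma bochner_ae f g : {ae mu, forall t, f t = g t} ->
  bochner mu f = bochner mu g.
Proof.
have sub f' g' : {ae mu, forall t, f' t = g' t} ->
    [set v : X | exists2 s, bochner_approx mu f' s &
      simple_bochner mu (s n) @[n --> \oo] --> v] `<=`
    [set v : X | exists2 s, bochner_approx mu g' s &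
      simple_bochner mu (s n) @[n --> \oo] --> v].
  by move=> fg v [s fs sv]; exists s => //; exact: bochner_approx_ae fs.
move=> fg; congr (xget 0 _); apply/seteqP; split; apply: sub => //.
by apply: filterS fg => t ->.
Qed.

(** |f| is at most |f - s n| + |s n|, and the integral of |f - s n| is eventually
less than 1. *)
Lemma bochner_integrable_lty f : discrete f -> bochner_integrable mu f ->
  (\int[mu]_t `|f t|%:E < +oo)%E.
Proof.
move=> df [s [is_ _ If]].
have [n In] : exists n, (\int[mu]_t `|f t - s n t|%:E < 1)%E.
  near \oo => n; exists n; near: n.
  have : nbhs (0 : \bar R)%E [set x | x < 1]%E.
    apply: open_nbhs_nbhs; split; last exact: lte01.
    exact: open_ereal_lt_ereal.
  exact: If.
have dn := integrable_simple_discrete (is_ n).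
have dc : discrete (cst 0 : T -> X).
  apply: discrete_finite; first exact: (fimfunP (cst_fimfun (0 : X))).
  by move=> y; rewrite preimage_cst; case: ifPn.
apply: (@le_lt_trans _ _ (\int[mu]_t `|f t - s n t|%:E + \int[mu]_t `|s n t - 0|%:E)%E).
  rewrite -ge0_integralD//; [|exact: discrete_normB|exact: discrete_normB].
  apply: ge0_le_integral => //.
  - by under eq_fun do rewrite -[f _]subr0; exact: discrete_normB.
  - by apply: emeasurable_funD; exact: discrete_normB.
  - move=> t _; rewrite -EFinD lee_fin subr0.
    by rewrite -{1}[f t](subrK (s n t)) ler_normD.
apply: lte_add_pinfty; first exact: lt_trans In (ltry _).
under eq_integral do rewrite subr0.
rewrite (@integral_fiberwise _ _ _ mu _ (s n) Num.norm (range (s n)))//; last first.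
  by case: (is_ n).
rewrite fsbig_finite//= big_seq; apply: lte_sum_pinfty => y _.
have [->|y0] := eqVneq y 0; first by rewrite normr0 mul0e.
by apply: lte_mul_pinfty => //; case: (is_ n) => _; exact.
Unshelve. all: by end_near. Qed.

(** Truncating a function of u to finitely many values of u approximates it, by
dominated convergence.  The integrals of the truncations are finite sums, on
which one can compute. *)
Lemma bochner_approx_truncation (Y : choiceType) (u : T -> Y) (psi : Y -> X)
    (D : nat -> set Y) :
  (mu setT < +oo)%E -> discrete u -> (forall n, finite_set (D n)) ->
  (forall y, \forall n \near \oo, D n y) ->
  bochner_integrable mu (psi \o u) ->
  exists2 s, bochner_approx mu (psi \o u) s &
    forall n, simple_bochner mu (s n) =
      \sum_(y \in D n) fine (mu (u @^-1` [set y])) *: psi y.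
Proof.
move=> muT du fD covD ipsi.
pose psin n y : X := if y \in D n then psi y else 0.
have /choice[s sE] n : exists s : {fimfun T >-> X}, s = psin n \o u :> (T -> X).
  suff fin : finite_set (range (psin n \o u)).
    by exists (fimfun_Sub (mem_set fin)).
  apply: (@sub_finite_set _ _ (psi @` D n `|` [set 0])).
    move=> _ [t _ <-]; rewrite /psin/=.
    by case: ifPn => [/set_mem Dt|_]; [left; exists (u t)|right].
  by rewrite finite_setU; split; [exact: finite_image|exact: finite_set1].
have fin A : measurable A -> (mu A < +oo)%E.
  by move=> mA; apply: le_lt_trans muT; apply: le_measure; rewrite ?inE.
have is_ n : integrable_simple mu (s n).
  have mn x : measurable (s n @^-1` [set x]).
    by rewrite sE; exact: (discrete_comp (psin n) du).2.
  by split=> // x _; exact: fin.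
have dpsi : discrete (psi \o u) by exact: discrete_comp.
exists s; last first.
  move=> n; rewrite (@simple_bochner_fiberwise _ u (psin n) (D n) (s n))//.
  - by apply: eq_fsbigr => y /= Dy; rewrite /psin Dy.
  - exact: du.2.
  - by move=> t Dt; rewrite /psin memNset.
  - by move=> y _; apply: fin; exact: du.2.
  - by move=> t; rewrite sE.
have cvs t : \forall n \near \oo, s n t = psi (u t).
  by near=> n; rewrite sE /psin/= mem_set//; near: n; exact: covD.
split=> //.
  apply: aeW => t; apply: cvg_near_cst; exact: cvs.
have mg : measurable_fun setT (fun t => `|psi (u t)|%:E).
  exact: (discrete_measurable (fun x : X => `|x|%:E) dpsi).
have mf n : measurable_fun setT (fun t => `|psi (u t) - s n t|%:E).
  by apply: discrete_normB => //; exact: integrable_simple_discrete.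
have [] := @dominated_convergence _ _ _ mu setT measurableT
  (fun n t => `|psi (u t) - s n t|%:E) (cst 0%E) (fun t => `|psi (u t)|%:E) mf.
- exact: measurable_cst.
- apply: aeW => t _; apply: cvg_near_cst; near=> n.
  rewrite (_ : s n t = psi (u t)) ?subrr ?normr0//.
  by near: n; exact: cvs.
- apply/integrableP; split => //.
  under eq_integral do rewrite gee0_abs ?lee_fin//.
  exact: bochner_integrable_lty dpsi ipsi.
- apply: aeW => t n _; rewrite gee0_abs ?lee_fin// sE /psin/=.
  by case: ifP => _; rewrite ?subrr ?normr0 ?subr0.
- by move=> _ _; rewrite integral0.
Unshelve. all: by end_near. Qed.

End bochner_theory.

(** * Sums against products of Poisson weights *)

Section poisson_weights.
Context {R : realType} {K : finType}.
Variable lam : K -> R.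
Hypothesis lam_ge0 : forall k, 0 <= lam k.
Local Notation counting := {ffun K -> nat}.
Implicit Types (v : counting) (k : K) (h : counting -> R).

(** At rate 0 this is the Dirac mass at 0, since 0 ^+ 0 = 1. *)
Definition poisson_weight (r : R) (j : nat) : R :=
  r ^+ j / j`!%:R * expR (- r).

Definition weight v : R := \prod_k poisson_weight (lam k) (v k).

Definition bump k v : counting := [ffun j => (v j + (j == k))%N].

Lemma weight_ge0 v : 0 <= weight v.
Proof.
apply: prodr_ge0 => k _.
by rewrite mulr_ge0 ?expR_ge0// divr_ge0 ?exprn_ge0.
Qed.

Lemma bump_inj k : injective (bump k).
Proof.
by move=> v w /ffunP vw; apply/ffunP => j; have := vw j; rewrite !ffunE => /addIn.
Qed.

(** The recursion r * r^j / j! = (j + 1) * r^(j + 1) / (j + 1)! in the coordinate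
k; it is the whole probabilistic content of the integration by parts. *)
Lemma weight_bump k v : weight (bump k v) * (v k).+1%:R = weight v * lam k.
Proof.
rewrite /weight (bigD1 k)//= [in RHS](bigD1 k)//=.
rewrite (eq_bigr (fun j => poisson_weight (lam j) (v j))); last first.
  by move=> j /negPf jk; rewrite ffunE jk addn0.
rewrite ffunE eqxx addn1 mulrAC [in RHS]mulrAC; congr (_ * _).
rewrite /poisson_weight exprS factS natrM.
have : (v k)`!%:R != 0 :> R by rewrite pnatr_eq0 -lt0n fact_gt0.
have : (v k).+1%:R != 0 :> R by [].
by move=> ? ?; field; apply/andP; split.
Qed.

Definition box n : set counting := [set v | forall k, (v k <= n)%N].

Lemma finite_box n : finite_set (box n).
Proof.
pose F (f : {ffun K -> 'I_n.+1}) : counting := [ffun k => f k : nat].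
apply: (@sub_finite_set _ _ (F @` setT)); last exact: finite_image.
move=> v vn; exists [ffun k => inord (v k)] => //.
by apply/ffunP => k; rewrite !ffunE inordK// ltnS.
Qed.

Lemma box_cover v : \forall n \near \oo, box n v.
Proof.
exists (\max_k v k)%N => // n /= vn k.
exact: leq_trans (leq_bigmax k) vn.
Qed.

Definition summable_weight h := (\esum_(v in setT) (weight v * h v)%:E < +oo)%E.

Lemma summable_weight_le h h' : (forall v, h v <= h' v) ->
  summable_weight h' -> summable_weight h.
Proof.
move=> hh'; apply: le_lt_trans; apply: le_esum => v _.
by rewrite lee_fin ler_wpM2l// weight_ge0.
Qed.

Lemma summable_weightD h h' : (forall v, 0 <= h v) -> (forall v, 0 <= h' v) ->
  summable_weight h -> summable_weight h' ->
  summable_weight (fun v => h v + h' v).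
Proof.
move=> h0 h'0 sh sh'; rewrite /summable_weight.
under eq_esum do rewrite mulrDr EFinD.
rewrite esumD; first exact: lte_add_pinfty.
- by move=> v _; rewrite lee_fin mulr_ge0// weight_ge0.
- by move=> v _; rewrite lee_fin mulr_ge0// weight_ge0.
Qed.

Lemma summable_weightZ c h : 0 <= c -> (forall v, 0 <= h v) ->
  summable_weight h -> summable_weight (fun v => c * h v).
Proof.
move=> c0 h0 sh; set S := (\esum_(v in setT) (weight v * h v)%:E)%E.
have S0 : (0 <= S)%E by apply: esum_ge0 => v _; rewrite lee_fin mulr_ge0// weight_ge0.
apply: (@le_lt_trans _ _ (c%:E * S)%E); last first.
  by apply: lte_mul_pinfty; rewrite ?lee_fin.
apply: ge_ereal_sup => _ [A [fA _] <-].
rewrite (eq_fsbigr (fun v => c%:E * (weight v * h v)%:E)%E); last first.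
  by move=> v _; rewrite -EFinM mulrCA.
rewrite -ge0_mule_fsumr; last by move=> v; rewrite lee_fin mulr_ge0// weight_ge0.
by apply: lee_wpmul2l; rewrite ?lee_fin//; apply: ereal_sup_ubound; exists A.
Qed.

Lemma summable_weight_sum (J : {set K}) (h : K -> counting -> R) :
  (forall k v, 0 <= h k v) ->
  (forall k, k \in J -> summable_weight (h k)) ->
  summable_weight (fun v => \sum_(k in J) h k v).
Proof.
move=> h0 sh; rewrite /summable_weight.
under eq_esum do rewrite mulr_sumr -sumEFin.
rewrite esum_sum; last by move=> v k _ _; rewrite lee_fin mulr_ge0// weight_ge0.
by apply: lte_sum_pinfty.
Qed.

(** By [weight_bump] and the substitution v := bump k v; the vectors with v k = 0
that the substitution misses contribute nothing to the hypothesis. *)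
Lemma summable_weight_bump k h : (forall v, 0 <= h v) ->
  summable_weight (fun v => (v k)%:R * h v) ->
  summable_weight (fun v => lam k * h (bump k v)).
Proof.
move=> h0; apply: le_lt_trans.
pose a v := (weight v * ((v k)%:R * h v))%:E.
have a0 v : (0 <= a v)%E by rewrite lee_fin !mulr_ge0// weight_ge0.
have -> : (\esum_(v in setT) (weight v * (lam k * h (bump k v)))%:E =
    \esum_(v in bump k @` setT) a v)%E.
  rewrite (@reindex_esum _ _ _ setT (bump k @` setT) (bump k))//.
    apply: eq_esum => v _; rewrite /a !mulrA -weight_bump.
    by rewrite ffunE eqxx addn1.
  by split => // v w _ _; exact: bump_inj.
rewrite esum_mkcond; apply: le_esum => v _.
by case: ifP => _; [exact: lexx|exact: a0].
Qed.

(** The face v k = n + 1 of box (n + 1) is disjoint from box n, so its sum is at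
most the increment of the convergent partial sums over boxes. *)
Lemma summable_weight_boundary k h : (forall v, 0 <= h v) ->
  summable_weight h ->
  \sum_(v \in box n `&` [set v | v k = n]) weight v * h v @[n --> \oo] --> 0.
Proof.
move=> h0 sh; set b := (fun n => _).
have wh0 v : 0 <= weight v * h v by rewrite mulr_ge0// weight_ge0.
pose S n := \sum_(v \in box n) weight v * h v.
have boxS n : box n `<=` box n.+1 by move=> v vn j; rewrite leqW.
have Sle (A B : set counting) : finite_set B -> A `<=` B ->
    \sum_(v \in A) weight v * h v <= \sum_(v \in B) weight v * h v.
  move=> fB AB; rewrite -lee_fin -!fsumEFin//; last exact: sub_finite_set fB.
  apply: lee_fsum_nneg_subset => //; first exact: sub_finite_set fB.
    exact/subsetP.
  by move=> v _; rewrite lee_fin.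
have cS : cvgn S.
  apply: nondecreasing_is_cvgn.
    by apply/nondecreasing_seqP => n; apply: Sle; [exact: finite_box|exact: boxS].
  exists (fine (\esum_(v in setT) (weight v * h v)%:E)%E) => _ [n _ <-].
  rewrite -lee_fin fineK; last first.
    by rewrite ge0_fin_numE//; apply: esum_ge0 => v _; rewrite lee_fin.
  rewrite -fsumEFin; last exact: finite_box.
  by apply: ereal_sup_ubound; exists (box n) => //; split => //; exact: finite_box.
rewrite -cvg_shiftS.
apply: (@squeeze_cvgr _ _ _ _ (cst 0) (fun n => S n.+1 - S n)).
- apply: nearW => n; apply/andP; split; first exact: fsumr_ge0.
  rewrite lerBrDr addrC /S /b -fsbigU//=.
  - apply: Sle; first exact: finite_box.
    by move=> v [/boxS|[]].
  - exact: finite_box.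
  - by apply: sub_finite_set (finite_box n.+1) => v [].
  - by move=> v [vn [_ /= vk]]; have := vn k; rewrite vk ltnn.
- exact: cvg_cst.
- rewrite -(subrr (limn S)); apply: cvgB => //.
  by have := cS; rewrite -cvg_shiftS.
Qed.

End poisson_weights.

(** * Summation by parts *)

(** The naturals other than r stay away from r; c bounds the inverse distances,
so that a function vanishing on the level m = r is controlled by its product
with m - r. *)
Lemma nat_far_from (R : realType) (r : R) : exists2 c, 0 < c &
  forall m : nat, m%:R != r -> 1 <= c * `|m%:R - r|.
Proof.
(* From M on, the distance to r is at least 1. *)
pose M := (Num.truncn `|r|).+2.
have rM : r + 1 <= M%:R.
  rewrite -natr1 lerD2r (le_trans (ler_norm r))// ltW//.
  by rewrite truncnS_gt.
have s0 : 0 <= \sum_(i < M) `|i%:R - r|^-1 by rewrite sumr_ge0// => i _; rewrite invr_ge0.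
exists (1 + \sum_(i < M) `|i%:R - r|^-1); first by rewrite ltr_wpDr.
move=> m mr; have dpos : 0 < `|m%:R - r| by rewrite normr_gt0 subr_eq0.
have [mM|Mm] := ltnP m M.
  rewrite -ler_pdivrMr// div1r (bigD1 (Ordinal mM))//= addrCA lerDl addr_ge0//.
  by rewrite sumr_ge0// => i _; rewrite invr_ge0.
rewrite mulrDl mul1r ler_wpDr ?mulr_ge0//.
rewrite (le_trans _ (ler_norm _))// lerBrDl (le_trans rM)//.
by rewrite ler_nat.
Qed.

Section poisson_parts.
Context {R : realType} {K : finType} {X : normedModType R}.
Variable lam : K -> R.
Hypothesis lam_ge0 : forall k, 0 <= lam k.
Variable J : {set K}.
Variable g : {ffun K -> nat} -> X.
Local Notation counting := {ffun K -> nat}.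
Implicit Types (v : counting) (k : K).

Definition increments v : X :=
  \sum_(k in J) lam k *: (g (bump k v) - g v).

Definition centred_product v : X :=
  ((\sum_(k in J) v k)%N%:R - \sum_(k in J) lam k) *: g v.

(** Shifting by [bump k] maps the part v k < n of the box onto the part v k > 0,
and [weight_bump] matches the terms.  What is left is the face v k = n of the
first sum, the face v k = 0 of the second sum being zero. *)
Lemma sum_by_parts n :
  \sum_(v \in box n) weight lam v *: increments v -
  \sum_(v \in box n) weight lam v *: centred_product v =
  \sum_(k in J) \sum_(v \in box n `&` [set v | v k = n])
    (weight lam v * lam k) *: g (bump k v).
Proof.
pose a k v := (weight lam v * lam k) *: g (bump k v).
pose b k v := (weight lam v * (v k)%:R) *: g v.
have fb := @finite_box K n.
have ab k : \sum_(v \in box n) a k v - \sum_(v \in box n) b k v =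
    \sum_(v \in box n `&` [set v | v k = n]) a k v.
  rewrite (@fsbigID _ _ _ _ [set v : counting | v k = n] (box n))//=.
  rewrite -addrA -[RHS]addr0; congr (_ + _).
  rewrite (@fsbigID _ _ _ _ [set v : counting | v k = 0%N] (box n))//=.
  rewrite [X in _ - (X + _)]fsbig1; last first.
    by move=> v [_ /= v0]; rewrite /b v0 mulr0 scale0r.
  rewrite add0r; apply/eqP; rewrite subr_eq0; apply/eqP.
  rewrite (@reindex_fsbig _ _ _ _ _ (bump k)
    (box n `&` ~` [set v | v k = n]) (box n `&` ~` [set v | v k = 0%N])).
    by apply: eq_fsbigr => v _; rewrite /a /b ffunE eqxx addn1 weight_bump.
  split.
  - move=> v [vn /= vk]; split; last by rewrite /= ffunE eqxx addn1.
    move=> j; rewrite ffunE; case: eqVneq => [->|_]; last by rewrite addn0.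
    by rewrite addn1 ltn_neqAle vn andbT; exact/eqP.
  - by move=> v w _ _; exact: bump_inj.
  - move=> v [vn /= vk]; exists [ffun j => (v j - (j == k))%N].
      split=> [j|/=]; first by rewrite ffunE; apply: leq_trans (vn j); exact: leq_subr.
      rewrite ffunE eqxx; have := vn k; lia.
    apply/ffunP => j; rewrite !ffunE; case: eqVneq => [->|_]; last by rewrite subn0 addn0.
    by rewrite subnK// lt0n; exact/eqP.
rewrite -(eq_bigr _ (fun k _ => ab k)) sumrB !fsbig_finite//=.
rewrite (eq_bigr _ (fun k _ => fsbig_finite _ (a k) fb)).
rewrite (eq_bigr _ (fun k _ => fsbig_finite _ (b k) fb)).
rewrite [X in _ = X - _]exchange_big [X in _ = _ - X]exchange_big/= -!sumrB.
apply: eq_bigr => v _; rewrite /a /b -scalerBr -sumrB.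
rewrite (eq_bigr (fun k => weight lam v *: (lam k *: g (bump k v)) -
    weight lam v *: ((v k)%:R *: g v))); last first.
  by move=> k _; rewrite !scalerA.
rewrite sumrB -!scaler_sumr -scalerBr; congr (_ *: _).
rewrite /increments /centred_product (eq_bigr _ (fun k _ => scalerBr _ _ _)) sumrB.
by rewrite -!scaler_suml scalerBl natr_sum opprB addrA subrK.
Qed.

(** Write a v for the total count over J and L for the total rate.  The factor
a v - L gives no control where a v = L.  The argument bounds in turn: g off
that level; by shifting, g (bump j v) on that level, as bumping leaves it; g on
that level, by solving the definition of [increments] for L * g v; and then
v k * g v everywhere, which shifts to the claim. *)
Lemma summable_bump :
  0 < \sum_(k in J) lam k ->
  summable_weight lam (fun v => `|increments v|) ->
  summable_weight lam (fun v => `|centred_product v|) ->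
  forall k, k \in J -> summable_weight lam (fun v => lam k * `|g (bump k v)|).
Proof.
set L := \sum_(k in J) lam k => L0 sD sC k kJ.
pose a v := (\sum_(k in J) v k)%N.
pose e v : bool := (a v)%:R == L.
have aC v : `|(a v)%:R - L| * `|g v| = `|centred_product v| by rewrite normrZ.
have va v j : j \in J -> ((v j)%:R : R) <= (a v)%:R.
  by move=> jJ; rewrite ler_nat /a (bigD1 j)//= leq_addr.
have s_off : summable_weight lam (fun v => (~~ e v)%:R * `|g v|).
  have [c c0 far] := nat_far_from L.
  apply: (@summable_weight_le _ _ _ lam_ge0 _ (fun v => c * `|centred_product v|)).
    move=> v; rewrite -aC mulrA ler_wpM2r//.
    by case: (boolP (e v)) => [_|/far]//=; rewrite mulr_ge0// ltW.
  by apply: summable_weightZ => //; exact: ltW.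
have s_off_mul j : j \in J ->
    summable_weight lam (fun v => (v j)%:R * ((~~ e v)%:R * `|g v|)).
  move=> jJ.
  apply: (@summable_weight_le _ _ _ lam_ge0 _
      (fun v => `|centred_product v| + L * ((~~ e v)%:R * `|g v|))).
    move=> v; rewrite -aC; case: (e v) => /=; first by rewrite !mul0r !mulr0 addr0 mulr_ge0.
    rewrite !mul1r -mulrDl ler_wpM2r// (le_trans (va v j jJ))//.
    by rewrite -lerBlDr ler_norm.
  apply: summable_weightD => //; first by move=> v; rewrite !mulr_ge0// ltW.
  by apply: summable_weightZ => //; exact: ltW.
have s_on_bump j : j \in J ->
    summable_weight lam (fun v => (e v)%:R * (lam j * `|g (bump j v)|)).
  move=> jJ.
  apply: (@summable_weight_le _ _ _ lam_ge0 _
      (fun v => lam j * ((~~ e (bump j v))%:R * `|g (bump j v)|))).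
    move=> v; rewrite mulrCA ler_wpM2l// ler_wpM2r//.
    (* One more point moves the total count off the level a = L. *)
    have abump : a (bump j v) = (a v).+1.
      rewrite /a (bigD1 j)//= [in RHS](bigD1 j)//= ffunE eqxx addn1 addSn.
      congr (_ + _).+1; apply: eq_bigr => i /andP[_ /negPf ij].
      by rewrite ffunE ij addn0.
    case: (boolP (e v)) => // /eqP ev; rewrite /e abump -ev eqr_nat.
    by rewrite gtn_eqF.
  apply: (@summable_weight_bump _ _ _ lam_ge0 j (fun v => (~~ e v)%:R * `|g v|)).
    by move=> v; rewrite mulr_ge0.
  exact: s_off_mul.
have s_on : summable_weight lam (fun v => (e v)%:R * `|g v|).
  apply: (@summable_weight_le _ _ _ lam_ge0 _ (fun v => L^-1 * (`|increments v| +
      \sum_(j in J) (e v)%:R * (lam j * `|g (bump j v)|)))).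
    move=> v; rewrite -[leLHS](mulKf (lt0r_neq0 L0)) ler_wpM2l//.
      by rewrite invr_ge0 ltW.
    have [ev|_] := boolP (e v); last first.
      by rewrite mul0r mulr0 addr_ge0// sumr_ge0// => j _; rewrite mul0r.
    rewrite mul1r -[L * _]ger0_norm ?mulr_ge0 ?(ltW L0)//.
    have -> : `|L * `|g v| | = `|L *: g v| by rewrite normrM normr_id normrZ.
    have -> : L *: g v = \sum_(j in J) lam j *: g (bump j v) - increments v.
      rewrite /increments (eq_bigr _ (fun k _ => scalerBr _ _ _)) sumrB -scaler_suml.
      by rewrite opprB addrC subrK.
    rewrite (le_trans (ler_normB _ _))// addrC lerD2l.
    rewrite (le_trans (ler_norm_sum _ _ _))// ler_sum// => j _.
    by rewrite normrZ mul1r ger0_norm.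
  apply: summable_weightZ => //; first by rewrite invr_ge0 ltW.
    by move=> v; rewrite addr_ge0// sumr_ge0// => j _; rewrite !mulr_ge0.
  apply: summable_weightD => //.
    by move=> v; rewrite sumr_ge0// => j _; rewrite !mulr_ge0.
  by apply: summable_weight_sum => // j v; rewrite !mulr_ge0.
apply: (@summable_weight_bump _ _ _ lam_ge0 k (fun v => `|g v|)) => //.
apply: (@summable_weight_le _ _ _ lam_ge0 _ (fun v =>
    (v k)%:R * ((~~ e v)%:R * `|g v|) + L * ((e v)%:R * `|g v|))).
  move=> v; have [ev|_] := boolP (e v); last by rewrite !mul1r mul0r mulr0 addr0.
  by rewrite mul0r mulr0 add0r mul1r ler_wpM2r// -(eqP ev) va.
apply: summable_weightD => //.
- by move=> v; rewrite !mulr_ge0// (ltW L0).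
- exact: s_off_mul.
- by apply: summable_weightZ => //; exact: ltW.
Qed.

Lemma cvg_sum_by_parts :
  summable_weight lam (fun v => `|increments v|) ->
  summable_weight lam (fun v => `|centred_product v|) ->
  \sum_(v \in box n) weight lam v *: increments v -
  \sum_(v \in box n) weight lam v *: centred_product v @[n --> \oo] --> 0.
Proof.
move=> sD sC; under eq_cvg do rewrite sum_by_parts.
have ac : continuous (fun x : X * X => x.1 + x.2) by exact: add_continuous.
suff : \sum_(k in J) \sum_(v \in box n `&` [set v | v k = n])
    (weight lam v * lam k) *: g (bump k v) @[n --> \oo] --> \sum_(k in J) (0 : X).
  by rewrite [in X in _ -> X](_ : 0 = \sum_(k in J) (0 : X))// big1.
refine (@cvg_big X K +%R 0 (fun k => k \in J) ac nat \oo (index_enum K)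
  (fun k n => \sum_(v \in box n `&` [set v | v k = n])
    (weight lam v * lam k) *: g (bump k v)) (fun=> 0) _ _); move=> k kJ /=.
have sk : summable_weight lam (fun v => lam k * `|g (bump k v)|).
  have [L0|] := eqVneq (\sum_(k in J) lam k) 0; last first.
    by move=> L0; apply: summable_bump => //; rewrite lt0r L0 sumr_ge0.
  have lk : lam k = 0.
    move/eqP: L0; rewrite psumr_eq0// => /allP/(_ k (mem_index_enum _)).
    by rewrite kJ => /eqP.
  by rewrite /summable_weight esum1// => v _; rewrite lk mul0r mulr0.
apply/norm_cvg0P.
apply: (@squeeze_cvgr _ _ _ _ (cst 0) (fun n => \sum_(v \in box n `&` [set v | v k = n])
    weight lam v * (lam k * `|g (bump k v)|))).
- have fB n : finite_set (box n `&` [set v : counting | v k = n]).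
    by apply: sub_finite_set (@finite_box K n) => v [].
  apply: nearW => n; rewrite normr_ge0/= !fsbig_finite//=.
  rewrite (le_trans (ler_norm_sum _ _ _))// ler_sum// => v _.
  by rewrite normrZ mulrA ger0_norm// mulr_ge0// weight_ge0.
- exact: cvg_cst.
- by apply: summable_weight_boundary => // v; rewrite mulr_ge0.
Qed.

End poisson_parts.

(** * The cells of a finite family of sets *)

Lemma fsbig_finType (V : nmodType) (K : finType) (p : pred K) (h : K -> V) :
  \sum_(k \in [set k | p k]) h k = \sum_(k | p k) h k.
Proof.
rewrite fsbig_mkcond (@fsbigE _ _ _ _ _ (index_enum K)) ?index_enum_uniq//.
  rewrite [RHS]big_mkcond; apply: eq_big => k; first by rewrite in_setT.
  by rewrite /patch mem_setE.
by move=> k _; rewrite mem_index_enum.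
Qed.

Section cells.
Context {T : Type} {L : finType}.
Variable A : L -> set T.

Definition signature (e : T) : {set L} := [set l | `[< A l e >]]%SET.

(** The intersection with the union only matters for the empty signature, whose
fibre may have infinite measure; it makes that cell empty. *)
Definition cell (S : {set L}) : set T :=
  signature @^-1` [set S] `&` \bigcup_l A l.

Lemma in_signature l e : (l \in signature e) <-> A l e.
Proof. by rewrite inE; split => /asboolP. Qed.

Lemma cell_in (S : {set L}) l : l \in S -> cell S = signature @^-1` [set S].
Proof.
move=> lS; apply/seteqP; split=> [e []//|e /= eS]; split=> //.
by exists l => //; apply/in_signature; rewrite eS.
Qed.

Lemma trivIset_cell : trivIset setT cell.
Proof. by move=> S S' _ _ [e [[/= <- _] [/= <- _]]]. Qed.

Lemma bigcup_cell l : A l = \bigcup_(S in [set S : {set L} | l \in S]) cell S.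
Proof.
apply/seteqP; split=> [e Ae|e [S /= lS [/= eS _]]]; last by apply/in_signature; rewrite eS.
by exists (signature e); [exact/in_signature|split=> //; exists l].
Qed.

End cells.

Section measure_cells.
Context {d : measure_display} {T : measurableType d} {R : realType}
  {L : finType}.
Variable A : L -> set T.
Hypothesis mA : forall l, measurable (A l).

Lemma discrete_signature : discrete (signature A).
Proof.
apply: discrete_finite; first exact: finite_finset.
move=> S.
have -> : signature A @^-1` [set S] =
    \bigcap_(l in [set: L]) [set e | l \in S <-> A l e].
  apply/seteqP; split=> [e /= <- l _|e /= H]; first exact: in_signature.
  by apply/setP => l; apply/idP/idP => [/in_signature/(H l I).2|/(H l I).1/in_signature].
apply: fin_bigcap_measurable => [|l _]; first exact: finite_finset.
have [lS|lS] := boolP (l \in S).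
  by rewrite (_ : [set e | _] = A l)//; apply/seteqP; split => e /=; [case=> /(_ isT)|].
rewrite (_ : [set e | _] = ~` A l); first exact: measurableC.
apply/seteqP; split => e /=; first by case=> _ H /H.
by move=> nA; split=> // /nA.
Qed.

Lemma measurable_cell S : measurable (cell A S).
Proof.
apply: measurableI; first exact: discrete_signature.2.
by apply: fin_bigcup_measurable => //; exact: finite_finset.
Qed.

Lemma measure_cells (m : {measure set T -> \bar R}) l :
  m (A l) = (\sum_(S : {set L} | l \in S) m (cell A S))%E.
Proof.
rewrite (bigcup_cell A l) measure_fin_bigcup.
- by rewrite fsbig_finType.
- exact: finite_finset.
- by move=> S S' _ _; exact: trivIset_cell.
- by move=> S _; exact: measurable_cell.
Qed.

Lemma cell_finite (m : {measure set T -> \bar R}) S :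
  (forall l, m (A l) < +oo)%E -> (m (cell A S) < +oo)%E.
Proof.
move=> fA; have [->|[l lS]] := set_0Vmem S.
  rewrite (_ : cell _ _ = set0) ?measure0//.
  by rewrite -subset0 => e [/= e0 [l _ /in_signature]]; rewrite e0 inE.
apply: le_lt_trans (fA l); apply: le_measure; rewrite ?inE//.
  exact: measurable_cell.
by rewrite (cell_in A lS) => e /= eS; apply/in_signature; rewrite eS.
Qed.

End measure_cells.

(** * The law of the counts *)

Section poisson_counts.
Context {dO dE : measure_display} {Omega : measurableType dO}
  {E : measurableType dE} {R : realType}.
Variables (P : probability Omega R) (mu : {measure set E -> \bar R}).
Variable N : R.-ker Omega ~> E.
Hypothesis hN : poisson_random_measure P mu N.

Lemma poisson_prob1 (r : R) j : 0 <= r ->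
  poisson_prob r 0%N [set j] = (poisson_weight r j)%:E.
Proof.
rewrite /poisson_prob /poisson_weight le_eqVlt => /predU1P[<-|r0].
  rewrite ltxx oppr0 expR0 mulr1 diracE expr0n; congr EFin.
  case: j => [|j]; first by rewrite mem_set// fact0 divr1.
  by rewrite memNset// mul0r.
by rewrite r0 esum_set1 ?lee_fin ?poisson_pmf_ge0// /poisson_pmf r0.
Qed.

Lemma measurable_count B (x : \bar R) : measurable B ->
  measurable [set w | N w B = x].
Proof.
move=> mB; have := measurable_kernel N B mB measurableT [set x] (emeasurable_set1 x).
by rewrite setTI.
Qed.

(** The Poisson probabilities of the finite values add up to 1. *)
Lemma count_finite B : finite_measure_set mu B ->
  {ae P, forall w, N w B = (Num.truncn (fine (N w B)))%:R%:E}.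
Proof.
move=> [mB fB]; have [hnat hpois _ _] := hN.
pose H (k : nat) := [set w | N w B = k%:R%:E].
have mH k : measurable (H k) by exact: measurable_count.
exists (~` \bigcup_k H k); split.
- by apply: measurableC; exact: bigcupT_measurable.
- rewrite probability_setC; last exact: bigcupT_measurable.
  suff -> : P (\bigcup_k H k) = 1%E by rewrite subee.
  rewrite measure_bigcup//; last first.
    by move=> i j _ _ [w []]; rewrite /H/= => -> [/eqP]; rewrite eqr_nat => /eqP.
  transitivity (poisson_prob (fine (mu B)) 0%N [set: nat]); last first.
    exact: probability_setT.
  have UE : [set: nat] = \bigcup_k [set k] by apply/seteqP; split => // k _; exists k.
  rewrite [in RHS]UE [RHS]measure_bigcup//; last by move=> i j _ _ [k [/= -> ->]].
  by apply: eq_eseriesr => k _; exact: hpois.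
- move=> w /= nw [k _]; rewrite /H/= => wk; apply: nw.
  by rewrite wk /= natrK.
Qed.

Lemma probability_ae_eq (A B : set Omega) : measurable A -> measurable B ->
  {ae P, forall w, A w <-> B w} -> P A = P B.
Proof.
move=> mA mB AB.
rewrite -[A]setIT -[B]setIT -!integral_indic//.
apply: ge0_ae_eq_integral => //.
- by apply/measurable_EFinP; exact: measurable_indic.
- by apply/measurable_EFinP; exact: measurable_indic.
apply: filterS AB => w AB _; congr EFin; rewrite !indicE; congr ((nat_of_bool _)%:R).
by apply/idP/idP => /set_mem/AB/mem_set.
Qed.

Section law.
Context {K : finType}.
Variable C : K -> set E.
Hypothesis fC : forall k, finite_measure_set mu (C k).
Hypothesis tC : trivIset setT C.

Definition cell_counts (w : Omega) : {ffun K -> nat} :=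
  [ffun k => Num.truncn (fine (N w (C k)))].

Lemma count_cells : {ae P, forall w k, N w (C k) = (cell_counts w k)%:R%:E}.
Proof.
apply: filter_forall => k.
by apply: filterS (count_finite (fC k)) => w; rewrite ffunE.
Qed.

Lemma discrete_cell_counts : discrete cell_counts.
Proof.
split=> [|v]; first exact: countableP.
have -> : cell_counts @^-1` [set v] = \bigcap_(k in [set: K])
    [set w | Num.truncn (fine (N w (C k))) = v k].
  apply/seteqP; split=> [w /= <- k _|w /= H]; first by rewrite /= ffunE.
  by apply/ffunP => k; rewrite ffunE; exact: H.
apply: fin_bigcap_measurable => [|k _]; first exact: finite_finset.
have [hnat _ _ _] := hN; have [mC _] := fC k.
(* The infinite counts are read as 0. *)
pose I := [set w | N w (C k) = +oo%E] `&` [set _ | v k = 0%N].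
have -> : [set w | Num.truncn (fine (N w (C k))) = v k] =
    [set w | N w (C k) = (v k)%:R%:E] `|` I.
  apply/seteqP; split=> w /=; last first.
    by case=> [->|[/= -> ->]] /=; rewrite ?natrK ?truncn0.
  case: (hnat w (C k) mC) => [Noo|[j Nj]]; last by rewrite Nj /= natrK => <-; left.
  by rewrite Noo /= truncn0 => v0; right; split.
apply: measurableU; first exact: measurable_count.
apply: measurableI; first exact: measurable_count.
have [v0|v0] := pselect (v k = 0%N).
  suff -> : [set _ : Omega | v k = 0%N] = setT by [].
  by apply/seteqP; split => w.
suff -> : [set _ : Omega | v k = 0%N] = set0 by [].
by apply/seteqP; split => w.
Qed.

(** Up to the null set where some count is infinite, the event says that the
counts take prescribed values, to which independence applies. *)
Lemma cell_counts_law v :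
  P (cell_counts @^-1` [set v]) =
    (weight (fun k => fine (mu (C k))) v)%:E.
Proof.
have [_ hpois _ hindep] := hN.
pose B := \bigcap_(i in [set: 'I_#|K|])
   ((fun w => N w (C (enum_val i))) @^-1` [set (v (enum_val i))%:R%:E]).
have mB : measurable B.
  apply: fin_bigcap_measurable => [|i _]; first exact: finite_finset.
  by apply: measurable_count; case: (fC (enum_val i)).
rewrite (@probability_ae_eq _ B)//; last first.
- apply: filterS count_cells => w cw; split.
    by move=> /= cv i _ /=; rewrite -cv -cw.
  move=> Bw; apply/ffunP => k; have := Bw (enum_rank k) I.
  by rewrite /= enum_rankK cw => -[/eqP]; rewrite eqr_nat => /eqP.
- exact: discrete_cell_counts.2.
rewrite /B (hindep _ (fun i => C (enum_val i)))//; last 2 first.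
- by move=> i; case: (fC (enum_val i)).
- by move=> i j _ _ ij; apply: enum_val_inj; exact: tC ij.
rewrite (eq_bigr (fun i => (poisson_weight
    (fine (mu (C (enum_val i)))) (v (enum_val i)))%:E)); last first.
  move=> i _; have [mC fCi] := fC (enum_val i).
  by rewrite -poisson_prob1 ?fine_ge0// -hpois.
rewrite prodEFin; congr EFin.
rewrite /weight (reindex (fun i : 'I_#|K| => enum_val i))//.
exact/onW_bij/enum_val_bij.
Qed.

End law.
End poisson_counts.

(** * Cylindrical functions and their derivative *)

(** A point lies in at most one of the disjoint sets, so at that point the sum
over the sets collapses to the effect of adding the point to the counts. *)
Lemma sum_increments_at (R : nzRingType) (V : lmodType R) M (c : 'rV[nat]_M)
    (Q : 'I_M -> Prop) (h : 'rV[nat]_M -> R) (y : V) (e : 'I_M -> R) :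
  (forall m m', Q m -> Q m' -> m = m') ->
  (forall m, e m = (`[< Q m >] : nat)%:R) ->
  \sum_m (h (c + delta_mx 0 m) - h c) *: (e m *: y) =
  (h (\row_m (c 0%R m + `[< Q m >])%N) - h c) *: y.
Proof.
move=> Q1 eQ; have [[m0 Qm0]|nQ] := pselect (exists m, Q m).
  rewrite (bigD1 m0)//= eQ asboolT// scale1r big1 ?addr0.
    congr ((h _ - _) *: _); apply/rowP => m; rewrite !mxE eqxx natn/=.
    have -> : `[< Q m >] = (m == m0) by apply/asboolP/eqP => [Qm|->//]; exact: Q1.
    by [].
  move=> m mm0; rewrite eQ asboolF ?scale0r ?scaler0// => Qm.
  by move/eqP: mm0; apply; exact: Q1.
rewrite big1 => [|m _]; last first.
  by rewrite eQ asboolF ?scale0r ?scaler0// => Qm; apply: nQ; exists m.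
suff -> : \row_m (c 0%R m + `[< Q m >])%N = c by rewrite subrr scale0r.
apply/rowP => m; rewrite mxE asboolF ?addn0// => Qm.
by apply: nQ; exists m.
Qed.

Section malliavin_theory.
Context {dO dE : measure_display} {Omega : measurableType dO}
  {E : measurableType dE} {R : realType}.
Variables (P : probability Omega R) (mu : {measure set E -> \bar R}).
Variable N : R.-ker Omega ~> E.
Hypothesis hN : poisson_random_measure P mu N.
Context {X : completeNormedModType R}.

Section refinement.
Context {L : finType}.
Variable A : L -> set E.
Hypothesis fA : forall l, finite_measure_set mu (A l).

Let mA l : measurable (A l). Proof. by case: (fA l). Qed.

Lemma finite_measure_cell S : finite_measure_set mu (cell A S).
Proof.
split; first exact: measurable_cell.
by apply: cell_finite => // l; case: (fA l).
Qed.

Lemma count_of_cells : {ae P, forall w l,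
  fine (N w (A l)) = (\sum_(S : {set L} | l \in S) cell_counts N (cell A) w S)%N%:R}.
Proof.
apply: filterS (count_cells hN finite_measure_cell) => w cw l.
rewrite (measure_cells mA) (eq_bigr _ (fun S _ => cw S)) sumEFin /=.
by rewrite natr_sum.
Qed.

Lemma mu_of_cells l :
  fine (mu (A l)) = \sum_(S : {set L} | l \in S) fine (mu (cell A S)).
Proof.
rewrite (measure_cells mA) (eq_bigr (fun S => (fine (mu (cell A S)))%:E)) ?sumEFin//.
move=> S _; rewrite fineK// ge0_fin_numE//.
by case: (finite_measure_cell S).
Qed.

End refinement.

(** The cells of all the sets occurring in the components serve as a common
disjoint family: almost surely the count of each set is the sum of the counts
of the cells it contains. *)
Lemma vcylindrical_disjoint (F : Omega -> X) : vcylindrical P mu N F ->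
  exists n M (f : 'I_n.+1 -> 'rV[nat]_M.+1 -> R) (B : 'I_M.+1 -> set E)
    (x : 'I_n.+1 -> X),
    [/\ forall m, finite_measure_set mu (B m), trivIset setT B &
      {ae P, forall w, F w = \sum_i f i (counts N B w) *: x i}].
Proof.
move=> [n [G [x [cG FG]]]].
pose rep := {M : nat & (('rV[nat]_M.+1 -> R) * ('I_M.+1 -> set E))%type}.
have /choice[r Hr] : forall i, exists r : rep,
    (forall m, finite_measure_set mu ((tagged r).2 m)) /\
    {ae P, forall w, G i w = (tagged r).1 (counts N (tagged r).2 w)}.
  move=> i; have [M [f [B [fB GB]]]] := cG i.
  by exists (existT _ M (f, B)).
pose L := {i : 'I_n.+1 & 'I_(tag (r i)).+1}.
pose A (l : L) := (tagged (r (tag l))).2 (tagged l).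
have fA l : finite_measure_set mu (A l) by exact: (Hr (tag l)).1.
(* Representations are indexed by ordinals, so the cells get numbered. *)
have eK : (#|{set L}|.-1).+1 = #|{set L}|.
  by rewrite prednK//; apply/card_gt0P; exists finset.set0.
pose rho m : {set L} := enum_val (cast_ord eK m).
pose rhoV (S : {set L}) := cast_ord (esym eK) (enum_rank S).
have rhoVK S : rho (rhoV S) = S by rewrite /rho /rhoV cast_ordKV enum_rankK.
pose f i (c : 'rV[nat]_(#|{set L}|.-1).+1) := (tagged (r i)).1
  (\row_m (\sum_(S : {set L} | existT _ i m \in S) c 0%R (rhoV S))%N).
exists n, (#|{set L}|.-1), f, (fun m => cell A (rho m)), x.
split; [|move=> p q _ _ pq|].
- by move=> m; exact: (finite_measure_cell fA).
- by have /enum_val_inj/cast_ord_inj := @trivIset_cell _ _ A (rho p) (rho q) I I pq.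
have Ga : {ae P, forall w i, G i w = (tagged (r i)).1 (counts N (tagged (r i)).2 w)}.
  by apply: filter_forall => i; exact: (Hr i).2.
apply: filterS2 (count_of_cells fA) Ga => w cA Gw.
rewrite FG; apply: eq_bigr => i _; congr (_ *: _).
have cE : counts N (tagged (r i)).2 w = \row_m (\sum_(S : {set L} |
    existT _ i m \in S) counts N (fun m => cell A (rho m)) w 0%R (rhoV S))%N.
  apply/rowP => m; rewrite !mxE.
  have := cA (existT _ i m); rewrite /A/= => ->; rewrite natrK.
  apply: eq_bigr => S _.
  by rewrite mxE rhoVK ffunE.
by rewrite Gw cE.
Qed.

Lemma malliavinP (F : Omega -> X) : vcylindrical P mu N F ->
  is_malliavin P mu N F (malliavin P mu N F).
Proof.
move=> /vcylindrical_disjoint[n [M [f [B [x [fB tB FE]]]]]].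
by apply: xgetPex; eexists; exists n, M, f, B, x; split.
Qed.

Section evaluation.
Variables (n M : nat) (f : 'I_n.+1 -> 'rV[nat]_M.+1 -> R).
Variables (B' : 'I_M.+1 -> set E) (x : 'I_n.+1 -> X) (B : set E).
Hypothesis fB' : forall m, finite_measure_set mu (B' m).
Hypothesis tB' : trivIset setT B'.
Hypothesis fB : finite_measure_set mu B.

(** The sets of the representation of F together with the set of integration. *)
Definition with_set (l : option 'I_M.+1) : set E :=
  if l is Some m then B' m else B.

Let L := option 'I_M.+1.
Let J : {set {set L}} := [set S : {set L} | None \in S]%SET.
Let lam (S : {set L}) : R := fine (mu (cell with_set S)).
Let fA l : finite_measure_set mu (with_set l).
Proof. by case: l. Qed.

(** The counts on which the coefficients f i depend, recovered from those of the
cells. *)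
Definition merge (v : {ffun {set L} -> nat}) : 'rV[nat]_M.+1 :=
  \row_m (\sum_(S : {set L} | Some m \in S) v S)%N.

Definition on_cells (v : {ffun {set L} -> nat}) : X :=
  \sum_i f i (merge v) *: x i.

Lemma merge_bump (S : {set L}) v :
  merge (bump S v) = \row_m (merge v 0%R m + (Some m \in S))%N.
Proof.
apply/rowP => m; rewrite !mxE (eq_bigr _ (fun S' _ => ffunE _ S')) big_split/=.
congr (_ + _)%N; have [mS|mS] := boolP (Some m \in S).
  by rewrite (bigD1 S)//= eqxx big1 ?addn0// => S' /andP[_ /negPf ->].
by rewrite big1// => S' mS'; case: eqVneq mS' mS => // -> ->.
Qed.

(** On a cell S inside B the derivative is the constant
on_cells (bump S v) - on_cells v, so the integrand is a simple function of the
signature. *)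
Lemma bochner_on_derivative v :
  bochner_on mu B (fun e => \sum_i \sum_m
     (f i (merge v + delta_mx 0 m) - f i (merge v)) *:
       ((\1_(B' m) e : R) *: x i)) =
  increments lam J on_cells v.
Proof.
pose sig := signature with_set.
pose Phi (S : {set L}) : X :=
  if None \in S then on_cells (bump S v) - on_cells v else 0.
have PhiE e : (\1_B e : R) *: \sum_i \sum_m
     (f i (merge v + delta_mx 0 m) - f i (merge v)) *:
       ((\1_(B' m) e : R) *: x i) = Phi (sig e).
  rewrite /Phi indicE; have [Be|Be] := pselect (B e); last first.
    rewrite memNset// scale0r ifN//.
    by apply/negP => /in_signature.
  rewrite mem_set// scale1r ifT; last exact/in_signature.
  rewrite /on_cells -sumrB; apply: eq_bigr => i _; rewrite -scalerBl.
  rewrite (@sum_increments_at _ _ _ _ (fun m => B' m e) _ _ (fun m => \1_(B' m) e)).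
  - congr ((f i _ - _) *: _); rewrite merge_bump; apply/rowP => m; rewrite !mxE.
    suff -> : `[< B' m e >] = (Some m \in sig e) by [].
    by apply/asboolP/idP => [Bm|/in_signature//]; exact/in_signature.
  - by move=> m m' Bm Bm'; apply: tB' => //; exists e.
  - move=> m; rewrite indicE.
    suff -> : (e \in B' m) = `[< B' m e >] by [].
    by apply/idP/idP => [/set_mem Bm|/asboolP/mem_set//]; exact/asboolP.
have mA l : measurable (with_set l) by case: (fA l).
have dsig : discrete sig by exact: discrete_signature.
have fin : finite_set (range (Phi \o sig)).
  apply: (@sub_finite_set _ _ (Phi @` setT)).
    by move=> _ [e _ <-]; exists (sig e).
  by apply: finite_image; exact: finite_finset.
pose s : {fimfun E >-> X} := fimfun_Sub (mem_set fin).
have sigJ (S : {set L}) : None \in S -> sig @^-1` [set S] = cell with_set S.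
  by move=> /cell_in ->.
have is_ : integrable_simple mu s.
  split=> y.
    exact: (discrete_comp Phi dsig).2.
  move=> y0; apply: (@le_lt_trans _ _ (mu B)); last by case: fB.
  have mB : measurable B by case: fB.
  apply: le_measure; rewrite ?inE//; first exact: (discrete_comp Phi dsig).2.
  move=> e /= ey; apply/(in_signature with_set None e); apply: contraT => nS.
  by move: y0; rewrite -[y]ey /Phi ifN// eqxx.
rewrite /bochner_on (_ : (fun e => _) = s); last by apply/funext => e; rewrite PhiE.
rewrite bochner_simple//.
rewrite (@simple_bochner_fiberwise _ _ _ _ mu _ sig Phi [set: {set L}])//.
- have -> : [set: {set L}] = [set S : {set L} | predT S].
    by apply/seteqP; split.
  rewrite fsbig_finType /increments big_mkcond [RHS]big_mkcond.
  apply: eq_bigr => S _; rewrite inE /Phi; case: ifP => NS; last by rewrite scaler0.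
  by rewrite sigJ.
- exact: finite_finset.
- exact: dsig.2.
- by move=> e nT; case: nT.
- move=> S; rewrite /Phi; case: ifP => NS; last by rewrite eqxx.
  move=> _; rewrite sigJ//; apply: cell_finite => // l; by case: (fA l).
Qed.

End evaluation.

End malliavin_theory.

(** * The duality *)

(* For an arbitrary f : N^M -> R the two expectations need not exist; the
   identity is asserted whenever both of them do. *)
Theorem proposition5p5 (R : realType)
    (dO : measure_display) (Omega : measurableType dO) (P : probability Omega R)
    (dE : measure_display) (E : measurableType dE)
    (mu : {sigma_finite_measure set E -> \bar R})
    (N : R.-ker Omega ~> E) (hN : poisson_random_measure P mu N)
    (X : completeNormedModType R)
    (F : Omega -> X) (hF : vcylindrical P mu N F)
    (B : set E) (hB : finite_measure_set mu B)
    (hDF : bochner_integrable P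
             (fun w => bochner_on mu B (malliavin P mu N F w)))
    (hNF : bochner_integrable P (fun w => compensated mu N B w *: F w)) :
  bochner P (fun w => bochner_on mu B (malliavin P mu N F w)) =
  bochner P (fun w => compensated mu N B w *: F w).
Proof.
have [n [M [f [B' [x [fB' tB' FE DE]]]]]] := malliavinP hN hF.
pose A := with_set B' B.
have fA l : finite_measure_set mu (A l) by case: l.
pose c := cell_counts N (cell A).
pose lam S := fine (mu (cell A S)).
pose J := [set S : {set option 'I_M.+1} | None \in S]%SET.
pose g := on_cells f x.
have fC := finite_measure_cell fA.
have lam_ge0 S : 0 <= lam S by rewrite fine_ge0.
have mergeE : {ae P, forall w, counts N B' w = merge (c w)}.
  apply: filterS (count_of_cells hN fA) => w cw; apply/rowP => m.
  by rewrite !mxE -[B' m]/(A (Some m)) cw natrK.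
have DE' : {ae P, forall w, bochner_on mu B (malliavin P mu N F w) =
    (increments lam J g \o c) w}.
  apply: filterS mergeE => w cw; rewrite DE cw.
  exact: bochner_on_derivative.
have CE : {ae P, forall w, compensated mu N B w *: F w =
    (centred_product lam J g \o c) w}.
  apply: filterS3 (count_of_cells hN fA) mergeE FE => w cw mw Fw.
  rewrite Fw mw /centred_product /compensated /=; congr (_ *: _); congr (_ - _).
    rewrite -[B]/(A None) cw; congr (_%:R).
    by apply: eq_bigl => S; rewrite inE.
  rewrite -[B]/(A None) (mu_of_cells fA).
  by apply: eq_bigl => S; rewrite inE.
rewrite (bochner_ae DE') (bochner_ae CE).
have dc : discrete c := discrete_cell_counts hN fC.
have law v : fine (P (c @^-1` [set v])) = weight lam v.
  by rewrite (cell_counts_law hN fC)//; exact: trivIset_cell.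
have summ (psi : {ffun {set option 'I_M.+1} -> nat} -> X) :
    bochner_integrable P (psi \o c) -> summable_weight lam (fun v => `|psi v|).
  move=> ipsi; rewrite /summable_weight.
  under eq_esum do rewrite -law.
  apply: le_lt_trans (esum_fiberwise_le P (r := fun v => `|psi v|) dc _) _ => //.
  by apply: bochner_integrable_lty ipsi; exact: discrete_comp.
have Pfin : (P setT < +oo)%E by rewrite probability_setT ltry.
have iD := bochner_integrable_ae DE' hDF.
have iC := bochner_integrable_ae CE hNF.
have [s sD sE] := bochner_approx_truncation Pfin dc (@finite_box _) (@box_cover _) iD.
have [s' sC sE'] := bochner_approx_truncation Pfin dc (@finite_box _) (@box_cover _) iC.
apply: (bochner_eq_of_approx _ _ sD sC); [exact: discrete_comp|exact: discrete_comp|].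
have lawbox (psi : {ffun {set option 'I_M.+1} -> nat} -> X) k :
    \sum_(v \in box k) fine (P (c @^-1` [set v])) *: psi v =
    \sum_(v \in box k) weight lam v *: psi v.
  by apply: eq_fsbigr => v _; rewrite law.
under eq_cvg do rewrite sE sE' !lawbox.
by apply: cvg_sum_by_parts => //; exact: summ.
Qed.
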